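(* Let $k\ge 2$. For each oriented word $u$ of rank $k$, the quasi-character $\tau_u:F_k\to\mathbb{R}$ is a function of small relative defect.
   Context: Let $k\ge 2$ and let $\mathcal{A}=\{a_1,\dots,a_k\}$ be a basis of the free group $F_k$. For $a\in\mathcal{A}$ the inverse is denoted by the corresponding uppercase letter ($A=a^{-1}$, $B=b^{-1}$, $A_i=a_i^{-1}$). Letters in $\mathcal{A}$ are called positive (lowercase), letters in $\mathcal{A}^{-1}$ negative (uppercase), and $\mathcal{A}^{\pm}=\mathcal{A}\cup\mathcal{A}^{-1}$. Elements of $F_k$ are identified with reduced group words over $\mathcal{A}^\pm$; $e$ is the trivial element. An oriented word of rank $k$ is a word of length $2k$ over $\mathcal{A}^\pm$ containing each letter of $\mathcal{A}^\pm$ exactly once. For distinct $x,y\in\mathcal{A}^\pm$, ''$x..y$ in $u$'' means that $x$ is to the left of $y$ in $u$. $\#_w(g)$ is the number of (possibly overlapping) occurrences of $w$ as a contiguous subword of $g$. For an oriented word $u$ of rank $k$ and a reduced word $g$, define $$\alpha_u(g)=\sum_{a,b\in\mathcal{A},\ A..B\text{ in }u}\#_{aB}(g)-\sum_{a,b\in\mathcal{A},\ a..b\text{ in }u}\#_{Ba}(g),$$ $$\beta_u(g)=\sum_{a,b\in\mathcal{A},\ A..b\text{ in }u}\#_{ab}(g)-\sum_{a,b\in\mathcal{A},\ A..b\text{ in }u}\#_{BA}(g)$$ (sums over ordered pairs $(a,b)$; in $\beta_u$ the case $a=b$ is allowed), and let $\omega(g)=\frac12$ if the last letter of $g$ is in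 $\mathcal{A}$, $\omega(g)=-\frac12$ if it is in $\mathcal{A}^{-1}$, $\omega(e)=0$. The weight induced by $u$ is $\tau_u=\alpha_u+\beta_u+\omega$ (always evaluated on reduced forms). A quasi-character of a group $G$ is a function $\varphi:G\to\mathbb{R}$ for which $|\varphi(g)+\varphi(h)-\varphi(gh)|$ is bounded over all $g,h\in G$. A function $\tau:G\to\mathbb{R}$ has small relative defect if (i) $\tau(e)=0$, and (ii) for all $g,h\in G$, if $g\ne e$ or $h\neq e$, then $|\tau(g)+\tau(h)-\tau(gh)|<|\tau(g)|+|\tau(h)|$. *)

(* Defs.v *)
From HB Require Import structures.
From mathcomp Require Import all_boot all_order all_algebra.
From mathcomp Require Import reals.

Set Implicit Arguments.
Unset Strict Implicit.
Unset Printing Implicit Defensive.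

Import Order.TTheory GRing.Theory Num.Theory.
Local Open Scope ring_scope.

(* The bit records whether the letter is negative: (i, false) stands for a_i  *)
(* and (i, true) for A_i = a_i^-1.                                            *)
Definition letter (k : nat) : finType := ('I_k * bool)%type.

Definition pos k (a : 'I_k) : letter k := (a, false).
Definition neg k (a : 'I_k) : letter k := (a, true).
Definition linv k (x : letter k) : letter k := (x.1, ~~ x.2).

Lemma linvK k : involutive (@linv k).
Proof. by case=> i b; rewrite /linv /= negbK. Qed.

Definition reduced k (w : seq (letter k)) : bool :=
  sorted (fun x y => y != linv x) w.

Definition cons_red k (x : letter k) (w : seq (letter k)) : seq (letter k) :=
  if w is y :: w' then if y == linv x then w' else x :: w else [:: x].

(* For reduced g and h, this is the reduced form of the concatenation g ++ h. *)
Definition mul_red k (g h : seq (letter k)) : seq (letter k) :=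
  foldr (@cons_red k) h g.

Definition inv_red k (g : seq (letter k)) : seq (letter k) :=
  rev (map (@linv k) g).

Lemma reduced_cons_red k (x : letter k) w : reduced w -> reduced (cons_red x w).
Proof.
case: w => [//|y w] /= yw; case: ifP => [_|/negbT yNx]; first exact: path_sorted yw.
by rewrite /reduced /= yNx.
Qed.

Lemma reduced_mul_red k (g h : seq (letter k)) :
  reduced h -> reduced (mul_red g h).
Proof. by move=> rh; elim: g => //= x g; apply: reduced_cons_red. Qed.

Lemma reduced_inv_red k (g : seq (letter k)) : reduced g -> reduced (inv_red g).
Proof.
rewrite /reduced /inv_red rev_sorted sorted_map; apply: sub_sorted => x y /=.
by rewrite linvK eq_sym.
Qed.

Lemma cons_redK k (x : letter k) w :
  reduced w -> cons_red x (cons_red (linv x) w) = w.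
Proof.
case: w => [|y w] /=; first by rewrite eqxx.
rewrite linvK; case: (eqVneq y x) => [-> |_ _] /=; last by rewrite eqxx.
by case: w => //= z w /andP[/negPf -> _].
Qed.

Lemma mul_red_cons_red k (x : letter k) g h :
  reduced h -> mul_red (cons_red x g) h = cons_red x (mul_red g h).
Proof.
move=> rh; case: g => [//|y g] /=; case: eqP => [-> |//].
by rewrite cons_redK // reduced_mul_red.
Qed.

Lemma mul_redA k (f g h : seq (letter k)) :
  reduced h -> mul_red f (mul_red g h) = mul_red (mul_red f g) h.
Proof. by move=> rh; elim: f => //= x f ->; rewrite mul_red_cons_red. Qed.

Lemma mul_red_nil k (g : seq (letter k)) : reduced g -> mul_red g [::] = g.
Proof.
elim: g => //= x g IHg rxg; rewrite IHg; last exact: path_sorted rxg.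
by case: g rxg {IHg} => //= y g /andP[/negPf ->].
Qed.

Lemma mul_inv_red k (g : seq (letter k)) : mul_red (inv_red g) g = [::].
Proof.
rewrite /mul_red /inv_red; elim: g => //= x g IHg.
by rewrite rev_cons foldr_rcons /= linvK eqxx.
Qed.

Lemma inv_redK k (g : seq (letter k)) : inv_red (inv_red g) = g.
Proof. by rewrite /inv_red map_rev revK mapK //; apply: linvK. Qed.

(* The free group F_k on a_0, ..., a_(k-1), as the group of reduced words.    *)
Record free_group (k : nat) : Type := FreeGroup {
  word :> seq (letter k);
  word_reduced : reduced word
}.

HB.instance Definition _ k := [isSub for @word k].
HB.instance Definition _ k := [Choice of free_group k by <:].

Definition fg_one k : free_group k := @FreeGroup k [::] isT.
Definition fg_mul k (g h : free_group k) : free_group k :=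
  FreeGroup (reduced_mul_red g (word_reduced h)).
Definition fg_inv k (g : free_group k) : free_group k :=
  FreeGroup (reduced_inv_red (word_reduced g)).

Lemma fg_mulA k : associative (@fg_mul k).
Proof. by move=> f g h; apply: val_inj; apply/mul_redA/word_reduced. Qed.

Lemma fg_mul1g k : left_id (@fg_one k) (@fg_mul k).
Proof. by move=> g; apply: val_inj. Qed.

Lemma fg_mulg1 k : right_id (@fg_one k) (@fg_mul k).
Proof. by move=> g; apply: val_inj; apply/mul_red_nil/word_reduced. Qed.

Lemma fg_mulVg k : left_inverse (@fg_one k) (@fg_inv k) (@fg_mul k).
Proof. by move=> g; apply: val_inj; apply: mul_inv_red. Qed.

Lemma fg_mulgV k : right_inverse (@fg_one k) (@fg_inv k) (@fg_mul k).
Proof.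
move=> g; apply: val_inj; rewrite /= -{1}(inv_redK (word g)).
exact: mul_inv_red.
Qed.

HB.instance Definition _ k := isGroup.Build (free_group k)
  (@fg_mulA k) (@fg_mul1g k) (@fg_mulg1 k) (@fg_mulVg k) (@fg_mulgV k).

Definition oriented_word k (u : seq (letter k)) : bool :=
  (size u == 2 * k)%N && [forall x : letter k, count_mem x u == 1%N].

(* "x..y in u"; in an oriented word each letter has exactly one position, and *)
(* the relation is strict, so it forces x and y to be distinct.               *)
Definition left_of k (u : seq (letter k)) (x y : letter k) : bool :=
  (index x u < index y u)%N.

Definition occ k (w g : seq (letter k)) : nat :=
  (\sum_(i < (size g).+1) prefix w (drop i g))%N.

Definition alpha (R : realType) k (u g : seq (letter k)) : R :=
  \sum_(a < k) \sum_(b < k | left_of u (neg a) (neg b))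
    (occ [:: pos a; neg b] g)%:R
  - \sum_(a < k) \sum_(b < k | left_of u (pos a) (pos b))
    (occ [:: neg b; pos a] g)%:R.

Definition beta (R : realType) k (u g : seq (letter k)) : R :=
  \sum_(a < k) \sum_(b < k | left_of u (neg a) (pos b))
    (occ [:: pos a; pos b] g)%:R
  - \sum_(a < k) \sum_(b < k | left_of u (neg a) (pos b))
    (occ [:: neg b; neg a] g)%:R.

Definition omega (R : realType) k (g : seq (letter k)) : R :=
  if g is x :: s then if (last x s).2 then - 2^-1 else 2^-1 else 0.

Definition tau (R : realType) k (u : seq (letter k)) (g : free_group k) : R :=
  alpha R u g + beta R u g + omega R g.

Definition quasi_character (R : realType) (G : groupType) (phi : G -> R) : Prop :=
  exists C : R, forall g h : G, `|phi g + phi h - phi (g * h)%g| <= C.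

Definition small_relative_defect (R : realType) (G : groupType) (t : G -> R) :
    Prop :=
  t 1%g = 0 /\
  forall g h : G, g <> 1%g \/ h <> 1%g ->
    `|t g + t h - t (g * h)%g| < `|t g| + `|t h|.

(* Main.v *)
Require Import Defs.
From mathcomp Require Import all_boot all_order all_algebra.
From mathcomp Require Import reals.
From mathcomp Require Import zify ring lra.

(** Write [g = x_1 ... x_n] and [X_i] for the inverse of [x_i].  The four sums
    defining [alpha] and [beta] say that a two-letter subword [x y] of [g]
    contributes [+1] if [x] is positive and [X..y] in [u], contributes [-1] if
    [x] is negative and [y..X] in [u], and contributes [0] otherwise.  Since
    [y] differs from [X] in a reduced word, this contribution is half of
    [sign x + s (X, y)], where [s (x, y)] is [1] if [x..y] in [u] and [-1] if
    [y..x] in [u].  The term [omega] supplies half of the sign of the last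
    letter, so
      [2 tau_u (g) = (exponent sum of g) + sum_(i < n) s (X_i, x_(i+1))].

    The right-hand side is an integer, here called [dtau].  Two facts about it
    suffice.

    - For [g] nontrivial it is a sum of [n + (n - 1)] units [1] or [-1], hence
      odd, so [|tau_u g| >= 1/2] ([odd_dtau]).
    - Its defect is at most [1] ([dtau_defect]).  The exponent sum is a
      homomorphism.  Write [g = p c] and [h = c^-1 q] with [p q] the reduced
      form of the product; as [s] is antisymmetric, the contributions of the
      interior of [c] and of [c^-1] cancel, as do those of [p] and [q] with the
      ones in [p q].  What is left is [s (x, y) + s (y, z) - s (x, z)], where
      [x] is the inverse of the last letter of [p], and [y] and [z] are the
      first letters of [c] and [q].  As [s] comes from a linear order this is
      at most [1] in absolute value.

    Hence the defect of [tau_u] is at most [1/2], whereas [|tau_u g| + |tau_u h|]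
    is at least [1] when [g] and [h] are both nontrivial; when one of them is
    trivial the defect is [0]. *)

Set Implicit Arguments.
Unset Strict Implicit.
Unset Printing Implicit Defensive.

Import Order.TTheory GRing.Theory Num.Theory.
Local Open Scope ring_scope.

(** * Reduced words: inverses and cancellation *)

Lemma inv_red_cons k (x : letter k) w :
  inv_red (x :: w) = inv_red w ++ [:: linv x].
Proof. by rewrite /inv_red /= rev_cons cats1. Qed.

Lemma mul_red_cons k (x : letter k) g h :
  mul_red (x :: g) h = cons_red x (mul_red g h).
Proof. by []. Qed.

(** Induction on [g]: a letter put in front of [g] can only cancel while [p] is
    empty, because otherwise its neighbour is still the one it has in [g]. *)
Lemma mul_red_cancel k (g h : seq (letter k)) : reduced g ->
  exists p c q, [/\ g = p ++ c, h = inv_red c ++ q & mul_red g h = p ++ q].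
Proof.
elim: g => [_|x g IHg rxg]; first by exists [::], [::], h.
have [|p [c [q [Eg Eh Egh]]]] := IHg; first exact: path_sorted rxg.
rewrite mul_red_cons Egh Eg {IHg Egh} in rxg *.
case: p => [|y p] in rxg Eg *; last first.
  by exists (x :: y :: p), c, q; split=> //=; case/andP: rxg => /negPf->.
case: q => [|z q] in Eh *; first by exists [:: x], c, [::].
have [zx|zx] := eqVneq z (linv x).
  exists [::], (x :: c), q; split=> //; last by rewrite /= zx eqxx.
  by rewrite inv_red_cons -catA Eh zx.
by exists [:: x], c, (z :: q); split; rewrite //= (negPf zx).
Qed.

(** * The doubled weight *)

Definition letter_sign k (x : letter k) : int := if x.2 then -1 else 1.

Definition exp_sum k (w : seq (letter k)) : int := \sum_(x <- w) letter_sign x.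

(** The sign [s (x, y)] of the order of [x] and [y] in [u].  The arguments are
    optional because they will be first letters of words that may be empty. *)
Definition order_sign k (u : seq (letter k)) (x y : option (letter k)) : int :=
  if (x, y) is (Some x, Some y) then
    if left_of u x y then 1 else if left_of u y x then -1 else 0
  else 0.

(** At each inner vertex of the path labelled [w], compare in [u] the two edges
    along which the path leaves that vertex: backwards [X_i], and forwards
    [x_(i+1)]. *)
Fixpoint turning k (u w : seq (letter k)) : int :=
  if w is x :: w' then order_sign u (Some (linv x)) (ohead w') + turning u w'
  else 0.

Definition dtau k (u w : seq (letter k)) : int := exp_sum w + turning u w.

Section Defect.

Variables (k : nat) (u : seq (letter k)).
Implicit Types (w p c q g h : seq (letter k)).

Lemma exp_sum_cat p q : exp_sum (p ++ q) = exp_sum p + exp_sum q.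
Proof. by rewrite /exp_sum big_cat. Qed.

Lemma exp_sum_inv w : exp_sum (inv_red w) = - exp_sum w.
Proof.
elim: w => [|x w IHw]; first by rewrite /exp_sum big_nil oppr0.
rewrite inv_red_cons exp_sum_cat IHw /exp_sum !big_cons big_nil.
by rewrite /letter_sign /linv /=; case: x.2 => /=; lia.
Qed.

Lemma order_sign_None x : order_sign u x None = 0.
Proof. by case: x. Qed.

Lemma order_signC x y : order_sign u x y = - order_sign u y x.
Proof.
case: x y => [x|] [y|]; rewrite /order_sign ?oppr0 // /left_of.
by repeat case: ifP; lia.
Qed.

(** For three letters at distinct positions the sum is [1] or [-1] according to
    their cyclic order in [u], and it vanishes if two of the positions coincide;
    if an argument is missing, at most one term survives. *)
Lemma order_sign_triangle x y z :
  `|order_sign u x y + order_sign u y z - order_sign u x z| <= 1.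
Proof.
case: x y z => [x|] [y|] [z|]; rewrite /order_sign /left_of //;
  repeat case: ifP; lia.
Qed.

Lemma turning_cons x w :
  turning u (x :: w) = order_sign u (Some (linv x)) (ohead w) + turning u w.
Proof. by []. Qed.

(** [ohead (inv_red p)] is the inverse of the last letter of [p]. *)
Lemma turning_cat p q : turning u (p ++ q) =
  turning u p + order_sign u (ohead (inv_red p)) (ohead q) + turning u q.
Proof.
elim: p => [|x [|y p] IHp]; first by rewrite /= !add0r.
  by rewrite /= order_sign_None !add0r.
rewrite cat_cons turning_cons IHp turning_cons inv_red_cons !addrA.
by rewrite !inv_red_cons; case: (inv_red p) => [|z r]; rewrite /= !addrA.
Qed.

Lemma turning_inv w : turning u (inv_red w) = - turning u w.
Proof.
elim: w => [//|x w IHw]; rewrite inv_red_cons turning_cat IHw inv_redK /=.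
by rewrite order_sign_None !addr0 order_signC opprD addrC.
Qed.

Lemma dtau_defect g h : reduced g ->
  `|dtau u g + dtau u h - dtau u (mul_red g h)| <= 1.
Proof.
move=> /mul_red_cancel -/(_ h)[p [c [q [-> -> ->]]]].
have := order_sign_triangle (ohead (inv_red p)) (ohead c) (ohead q).
rewrite /dtau !exp_sum_cat !turning_cat exp_sum_inv turning_inv inv_redK.
lia.
Qed.

End Defect.

Section OrientedWord.

Variables (R : realType) (k : nat) (u : seq (letter k)).
Hypothesis hu : oriented_word u.
Implicit Types (x y : letter k) (w : seq (letter k)).

Lemma mem_oriented x : x \in u.
Proof.
by case/andP: hu => _ /forallP/(_ x)/eqP ux; rewrite -has_pred1 has_count ux.
Qed.

Lemma left_ofNC x y : y != x -> left_of u y x = ~~ left_of u x y.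
Proof.
move=> yx; rewrite /left_of -leqNgt [RHS]leq_eqVlt; case: eqP => // Eyx.
by case/eqP: yx; apply: (index_inj x (mem_oriented y) (mem_oriented x)).
Qed.

Lemma odd_dtau w : reduced w -> exists m, dtau u w = m * 2 + (w != [::])%:Z.
Proof.
elim: w => [_|x w IHw rxw]; first by exists 0; rewrite /dtau /exp_sum big_nil.
have [|m {IHw}] := IHw; first exact: path_sorted rxw.
rewrite /dtau turning_cons /exp_sum big_cons -/(exp_sum w) => Em.
have [s Es] : exists s, letter_sign x = s * 2 + 1.
  by rewrite /letter_sign; case: x.2; [exists (-1) | exists 0].
case: w => [|y w] in rxw Em *.
  by exists (m + s); rewrite order_sign_None; move: Em; rewrite /=; lia.
have [t Et] : exists t, order_sign u (Some (linv x)) (Some y) = t * 2 + 1.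
  case/andP: rxw => yx _; rewrite /order_sign (left_ofNC yx).
  by case: left_of; [exists 0 | exists (-1)].
by exists (m + s + t + 1); rewrite [ohead _]/= Et; move: Em => /=; lia.
Qed.

(** * The weight as half of the doubled weight *)

Lemma occ_cons v x w : occ v (x :: w) = (prefix v (x :: w) + occ v w)%N.
Proof. by rewrite /occ big_ord_recl drop0. Qed.

Lemma occ_pair1 x y z : occ [:: x; y] [:: z] = 0%N.
Proof. by rewrite occ_cons /occ big_ord1 /= andbF. Qed.

Lemma sum_occ_cons2 (P : rel 'I_k) (s t : bool) x y w :
  \sum_(a < k) \sum_(b < k | P a b) (occ [:: (a, s); (b, t)] [:: x, y & w])%:R =
  [&& x.2 == s, y.2 == t & P x.1 y.1]%:R +
  \sum_(a < k) \sum_(b < k | P a b) (occ [:: (a, s); (b, t)] (y :: w))%:R :> R.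
Proof.
case: x y => [i s'] [j t']; rewrite /=.
under eq_bigr => a _ do under eq_bigr => b _ do
  rewrite occ_cons natrD [prefix _ _]/= prefix0s andbT.
under eq_bigr => a _ do rewrite big_split /=.
rewrite big_split /=; congr (_ + _).
rewrite (bigD1 i) //= [X in _ + X]big1 ?addr0; last first.
  move=> a ai; apply: big1 => b _.
  by rewrite xpair_eqE (negPf ai).
rewrite big_mkcond (bigD1 j) //= [X in _ + X]big1 ?addr0; last first.
  by move=> b bj; rewrite !xpair_eqE (negPf bj) andbF if_same.
rewrite !xpair_eqE !eqxx /= [s' == s]eq_sym [t' == t]eq_sym.
by case: P; rewrite /= ?andbT ?andbF.
Qed.

Lemma sum_occ1 (P : rel 'I_k) (s t : bool) x :
  \sum_(a < k) \sum_(b < k | P a b) (occ [:: (a, s); (b, t)] [:: x])%:R = 0 :> R.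
Proof. by apply: big1 => a _; apply: big1 => b _; rewrite occ_pair1. Qed.

(** In the subtracted sums of [alpha] and [beta] the outer index belongs to the
    second letter of the pair; exchanging the sums puts all four in one form. *)
Lemma sum_occ_swap (P : rel 'I_k) (s t : bool) w :
  \sum_(a < k) \sum_(b < k | P a b) (occ [:: (b, s); (a, t)] w)%:R =
  \sum_(b < k) \sum_(a < k | P a b) (occ [:: (b, s); (a, t)] w)%:R :> R.
Proof. exact: exchange_big_dep. Qed.

Lemma alpha_beta1 x : alpha R u [:: x] + beta R u [:: x] = 0.
Proof. by rewrite /alpha /beta !(sum_occ_swap, sum_occ1) subrr addr0. Qed.

(** Reducedness enters here: as [y] differs from the inverse [X] of [x], exactly
    one of [X..y] and [y..X] holds, so the indicator counted by [alpha] and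
    [beta] is the average of two signs. *)
Lemma alpha_beta_cons2 x y w : y != linv x ->
  alpha R u [:: x, y & w] + beta R u [:: x, y & w] =
  (letter_sign x + order_sign u (Some (linv x)) (Some y))%:~R / 2
  + (alpha R u (y :: w) + beta R u (y :: w)).
Proof.
move=> yx; rewrite /alpha /beta !(sum_occ_swap, sum_occ_cons2) /=.
have := left_ofNC yx; rewrite /order_sign /letter_sign /neg /pos.
case: x y yx => [i []] [j []] _; rewrite /linv /= => ->;
  by case: left_of => /=; field.
Qed.

Lemma tau_dtau (g : free_group k) : tau R u g = (dtau u g)%:~R / 2.
Proof.
case: g => w rw; rewrite /tau /=; elim: w rw => [_|x [|y w] IHw rxw].
- rewrite /alpha /beta /dtau /exp_sum big_nil /= mul0r addr0.
  by rewrite !big1 ?subrr ?addr0 // => a _; apply: big1 => b _;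
    rewrite /occ big_ord1.
- rewrite alpha_beta1 /dtau /exp_sum big_seq1 /= /letter_sign.
  by case: x.2; rewrite /=; field.
have /andP[yx ryw] : (y != linv x) && reduced (y :: w) by [].
rewrite (alpha_beta_cons2 _ yx) -[omega R _]/(omega R (y :: w)) -[LHS]addrA.
rewrite IHw //.
by rewrite /dtau /exp_sum [in RHS]big_cons /= !rmorphD /=; field.
Qed.

Lemma tau1 : tau R u (1%g : free_group k) = 0.
Proof. by rewrite tau_dtau /dtau /exp_sum big_nil mul0r. Qed.

Lemma tau_defect (g h : free_group k) :
  `|tau R u g + tau R u h - tau R u (g * h)%g| <= 2^-1.
Proof.
rewrite !tau_dtau -mulrDl -mulrBl -rmorphD -rmorphB /= normrM.
rewrite [`|2^-1|]ger0_norm ?invr_ge0 // ler_piMl ?invr_ge0 //.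
by rewrite -intr_norm -[1]/(1%:~R) ler_int dtau_defect // word_reduced.
Qed.

Lemma tau_ge_half (g : free_group k) : g != 1%g -> 2^-1 <= `|tau R u g|.
Proof.
move=> g1; rewrite tau_dtau normrM [`|2^-1|]ger0_norm ?invr_ge0 //.
rewrite ler_peMl ?invr_ge0 // -intr_norm -[1]/(1%:~R) ler_int.
have [m ->] := odd_dtau (word_reduced g).
have -> : word g != [::] by apply: contraNneq g1 => g0; apply/eqP/val_inj.
lia.
Qed.

End OrientedWord.

Theorem corollary14 (R : realType) (k : nat) (hk : (2 <= k)%N)
    (u : seq (letter k)) (hu : oriented_word u) :
  quasi_character (tau R u : free_group k -> R) /\
  small_relative_defect (tau R u : free_group k -> R).
Proof.
split; first by exists 2^-1 => g h; apply: tau_defect.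
split=> [|g h gh1]; first exact: tau1.
have [g1|g1] := eqVneq g 1%g.
  have h1 : h != 1%g by case: gh1 => [/(_ g1)|/eqP].
  by rewrite g1 mul1g tau1 // add0r subrr normr0 add0r;
    have := tau_ge_half R hu h1; lra.
have [h1|h1] := eqVneq h 1%g.
  by rewrite h1 mulg1 tau1 // addr0 subrr normr0 addr0;
    have := tau_ge_half R hu g1; lra.
have := tau_defect R hu g h; have := tau_ge_half R hu g1.
have := tau_ge_half R hu h1; lra.
Qed.
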